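(* Let $k\ge 1$ be an integer and let $(V,\beta)$ be the vector space over $GF(2)$ with basis $\{e_i,e_i^* : 1\le i\le k\}\cup\{e_i : i\in\omega,\ i>k\}$ and bilinear skew symmetric form $\beta$ such that the pairs $(e_i,e_i^* )$, $1\le i\le k$, are pairwise orthogonal hyperbolic pairs and $\mathsf{Rad}(V)=\bigoplus_{i>k}\langle e_i\rangle$. Let $A<B$ be any finite subspaces of $V$ such that $B\neq\mathsf{Rad}(B)$ and $$1\le [A:A\cap\mathsf{Rad}(V)]<[B:\mathsf{Rad}(B)],$$ where $[X:Y]$ denotes the codimension of the subspace $Y$ in $X$. Then the age of $(V,\beta)$ does not satisfy the Ramsey property with respect to copies of $A<B$. That is, there is $r\in\omega$ such that for no finite subspace $C$ of $V$ does $C\rightarrow(B)^A_r$ hold.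
   Context: For a subspace $X$ of $V$, $\mathsf{Rad}(X)=\{u\in X : \beta(u,x)=0\text{ for all }x\in X\}$. A hyperbolic pair is a pair $u,v$ with $\beta(u,u)=\beta(v,v)=0$ and $\beta(u,v)=1$. Substructures of $(V,\beta)$ are subspaces with the restricted form, and isomorphisms between them are linear isometries. The age of $(V,\beta)$ is the class of (isomorphism types of) its finite substructures. For finite structures $A$ and $C$, ${C\choose A}$ denotes the set of all substructures of $C$ isomorphic to $A$. $C\rightarrow(B)^A_r$ means that for each coloring $\xi:{C\choose A}\to r$ (with $r$ colors) there is a substructure $B'\le C$ isomorphic to $B$ such that $\xi$ is constant on ${B'\choose A}$. *)

(* Defs.v *)
From HB Require Import structures.
From mathcomp Require Import all_boot all_order all_algebra sesquilinear.
From mathcomp Require Import boolp classical_sets functions cardinality.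

Set Implicit Arguments.
Unset Strict Implicit.
Unset Printing Implicit Defensive.

Import GRing.Theory.
Local Open Scope classical_set_scope.
Local Open Scope ring_scope.

Section Bases.
Context {F : fieldType} {V : lmodType F}.

Definition linear_span (I : Type) (b : I -> V) : set V :=
  [set v | exists (s : seq I) (c : I -> F), v = \sum_(i <- s) c i *: b i].

Definition independent_mod (I : eqType) (Y : set V) (b : I -> V) : Prop :=
  forall (s : seq I) (c : I -> F), uniq s ->
    Y (\sum_(i <- s) c i *: b i) -> {in s, forall i, c i = 0}.

(* The classes of the b i form a basis of the quotient space X / Y. *)
Definition quotient_basis (I : eqType) (X Y : set V) (b : I -> V) : Prop :=
  [/\ forall i, X (b i), independent_mod Y b
    & forall x, X x -> exists2 v, linear_span b v & Y (x - v)].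

Definition is_basis (I : eqType) (b : I -> V) : Prop :=
  quotient_basis [set: V] [set 0] b.

(* [X : Y] = n, for a subspace Y of X. *)
Definition is_codim (X Y : set V) (n : nat) : Prop :=
  exists b : 'I_n -> V, quotient_basis X Y b.

Definition finite_subspace (X : set V) : Prop :=
  submod_closed [in X] /\ finite_set X.

End Bases.

Section Forms.
Context {F : fieldType} {V : lmodType F}.
Variable beta : {skew_symmetric V}.

Definition Rad (X : set V) : set V :=
  [set u | X u /\ forall x, X x -> beta u x = 0].

Definition hyperbolic_pair (u v : V) : Prop :=
  [/\ beta u u = 0, beta v v = 0 & beta u v = 1].

(* Only the restriction of f to X matters. *)
Definition linear_isometry (X Y : set V) (f : V -> V) : Prop :=
  [/\ set_bij X Y f,
      forall a u v, X u -> X v -> f (a *: u + v) = a *: f u + f v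
    & forall u v, X u -> X v -> beta (f u) (f v) = beta u v].

Definition isomorphic (X Y : set V) : Prop :=
  exists f : V -> V, linear_isometry X Y f.

(* The binomial (C choose A). *)
Definition copies (A C : set V) : set (set V) :=
  [set X | [/\ finite_subspace X, X `<=` C & isomorphic A X]].

(* C -> (B)^A_r *)
Definition arrow (C B A : set V) (r : nat) : Prop :=
  forall xi : copies A C -> 'I_r,
    exists2 B', copies B C B' &
      forall X Y : copies A C,
        copies A B' (val X) -> copies A B' (val Y) -> xi X = xi Y.

End Forms.

(* The basis vectors e_i^* (i < k) and e_i (i in nat); indices start at 0. *)
Definition basis_family (V : Type) (k : nat) (e : nat -> V) (es : 'I_k -> V)
    (i : 'I_k + nat) : V :=
  match i with inl i => es i | inr i => e i end.

(* Main.v *)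
(** Colour a subspace by its image in the finite space V / Rad V.  If all copies
of A inside a copy of B had the same colour, then any two isometric embeddings
g, h : A -> B would satisfy g A <= h A + Rad B.  Suppose first that A is not
contained in Rad B.  Moving A by the transvection along a vector w of B that is
not orthogonal to A shows that w lies in A + Rad B; such vectors w generate B,
so B = A + Rad B and b <= a.  Suppose next that A is contained in Rad B.  As
a >= 1, some x in A and v in V satisfy beta(x, v) = 1, and for any s in B
outside Rad B the map y |-> y + beta(y, v) (s - x) embeds A isometrically in B
and sends x to s, whence s lies in A + Rad B = Rad B, a contradiction. *)

Require Import Defs.
From HB Require Import structures.
From mathcomp Require Import all_boot all_order all_algebra sesquilinear.
From mathcomp Require Import boolp classical_sets functions cardinality.

Set Implicit Arguments.
Unset Strict Implicit.
Unset Printing Implicit Defensive.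

Import GRing.Theory.
Local Open Scope classical_set_scope.
Local Open Scope ring_scope.

Section Subspaces.
Context {F : fieldType} {V : lmodType F}.

Lemma submod_setP (X : set V) :
  submod_closed [in X] <->
  X 0 /\ forall a u v, X u -> X v -> X (a *: u + v).
Proof.
split=> [[X0 XD]|[X0 XD]]; split; rewrite ?inE //.
- by move: X0; rewrite inE.
- by move=> a u v Xu Xv; have := XD a u v; rewrite !inE; apply.
- by move=> a u v; rewrite !inE; apply: XD.
Qed.

Lemma submodB (X : set V) (u v : V) :
  submod_closed [in X] -> X u -> X v -> X (u - v).
Proof.
move=> /submod_setP[_ XD] Xu Xv.
by have := XD (-1) _ _ Xv Xu; rewrite scaleN1r addrC.
Qed.

(** The sequence behind a span may repeat an index, so coefficients are collected one term at a
    time. *)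
Lemma linear_span_fin (I : finType) (b : I -> V) (v : V) :
  linear_span b v -> exists c : I -> F, v = \sum_i c i *: b i.
Proof.
move=> [s [c ->]]; elim: s => [|j s [d dE]].
  by exists (fun=> 0); rewrite big_nil big1 // => i _; rewrite scale0r.
exists (fun i => (i == j)%:R * c i + d i); rewrite big_cons dE.
under [RHS]eq_bigr do rewrite scalerDl.
rewrite big_split /= [X in _ = X + _](bigD1 j) //= eqxx mul1r.
rewrite [X in _ + X + _]big1 ?addr0 //.
by move=> i /negPf ->; rewrite mul0r scale0r.
Qed.

(** Since [X] lies in [X' + Y], each [b i] is modulo [Y] a combination of the [b' j]. Independence
    of [b] modulo [Y] makes the rows of the coefficient matrix independent, so there are at most as
    many rows as columns. *)
Lemma codim_le (X Y X' Y' : set V) (m n : nat) :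
  submod_closed [in Y] -> Y' `<=` Y ->
  (forall x, X x -> exists2 x', X' x' & Y (x - x')) ->
  is_codim X Y m -> is_codim X' Y' n -> (m <= n)%N.
Proof.
move=> /submod_setP[Y0 YD] sY'Y sXX' [b [Xb indb _]] [b' [_ _ genb']].
have YDr u v : Y u -> Y v -> Y (u + v).
  by move=> Yu Yv; have := YD 1 u v Yu Yv; rewrite scale1r.
have YZ a u : Y u -> Y (a *: u).
  by move=> Yu; have := YD a u 0 Yu Y0; rewrite addr0.
have bE i : exists c : 'I_n -> F, Y (b i - \sum_j c j *: b' j).
  have [x' X'x' Yx'] := sXX' _ (Xb i).
  have [v /linear_span_fin[c ->] Y'v] := genb' _ X'x'.
  exists c; rewrite -(subrK x' (b i)) -addrA.
  by apply: YDr => //; apply: sY'Y.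
pose M := \matrix_(i < m, j < n) sval (cid (bE i)) j.
have YM i : Y (b i - \sum_j M i j *: b' j).
  under eq_bigr do rewrite mxE.
  exact: (svalP (cid (bE i))).
have /row_freeP[N MN] : row_free M.
  (* For a row [u] with [u *m M = 0], subtracting the [b'] parts does not change the combination of
     the [b i] with coefficients [u], which therefore lies in [Y]; hence [u = 0]. *)
  rewrite -kermx_eq0; apply/eqP/row_matrixP => l; rewrite row0.
  set u := row l _.
  have uM : u *m M = 0 by rewrite /u -row_mul mulmx_ker row0.
  have Ysum : Y (\sum_i u 0 i *: b i).
    have -> : \sum_i u 0 i *: b i =
        \sum_i u 0 i *: (b i - \sum_j M i j *: b' j).
      under [RHS]eq_bigr do rewrite scalerBr.
      rewrite sumrB [X in _ - X](_ : _ = 0) ?subr0 //.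
      under eq_bigr do rewrite scaler_sumr.
      rewrite exchange_big big1 //= => j _.
      under eq_bigr do rewrite scalerA.
      rewrite -scaler_suml.
      by move/matrixP: uM => /(_ 0 j); rewrite !mxE => ->; rewrite scale0r.
    by elim/big_ind: _ => // i _; apply: YZ.
  apply/rowP => i; rewrite [RHS]mxE.
  by apply: (indb _ _ (index_enum_uniq _) Ysum); rewrite mem_index_enum.
apply: (leq_trans _ (rank_leq_col M)).
by have /eqP -> : row_free M by apply/row_freeP; exists N.
Qed.

End Subspaces.

Section Forms.
Context {F : fieldType} {V : lmodType F} (beta : {skew_symmetric V}).

Lemma skewC u v : beta u v = - beta v u.
Proof. by rewrite hermC expr1 mulN1r. Qed.

Lemma submod_Rad (X : set V) :
  submod_closed [in X] -> submod_closed [in Rad beta X].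
Proof.
move=> /submod_setP[X0 XD]; apply/submod_setP; split.
  by split=> // x _; rewrite linear0l.
move=> a u v [Xu ru] [Xv rv]; split=> [|x Xx]; first exact: XD.
by rewrite linearPl /= ru // rv // mulr0 addr0.
Qed.

Definition isometric_embedding (X Y : set V) (f : V -> V) : Prop :=
  [/\ set_fun X Y f, set_inj X f,
      forall a u v, X u -> X v -> f (a *: u + v) = a *: f u + f v
    & forall u v, X u -> X v -> beta (f u) (f v) = beta u v].

Lemma isometric_embedding_comp (X Y Z : set V) (f g : V -> V) :
  isometric_embedding X Y f -> isometric_embedding Y Z g ->
  isometric_embedding X Z (g \o f).
Proof.
move=> [fXY fI fL fB] [gYZ gI gL gB]; split=> /=.
- by move=> x /fXY/gYZ.
- move=> x y Xx Xy /= /gI gE; apply: fI => //.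
  by apply: gE; rewrite inE; apply: fXY; apply: set_mem.
- by move=> a u v Xu Xv; rewrite fL // gL //; apply: fXY.
- by move=> u v Xu Xv; rewrite gB ?fB //; apply: fXY.
Qed.

Lemma isometric_embedding_sub (X Y : set V) :
  X `<=` Y -> isometric_embedding X Y id.
Proof. by move=> sXY; split. Qed.

Lemma copies_image (X Y Z : set V) (f : V -> V) :
  finite_subspace X -> isometric_embedding X Y f -> Y `<=` Z ->
  copies beta X Z (f @` X).
Proof.
move=> [/submod_setP[X0 XD] finX] [fXY fI fL fB] sYZ; split.
- split; last exact: finite_image.
  apply/submod_setP; split.
    exists 0 => //.
    by have := fL (-1) 0 0 X0 X0; rewrite !scaleN1r oppr0 addr0 addNr.
  move=> a _ _ [u Xu <-] [v Xv <-]; exists (a *: u + v); first exact: XD.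
  exact: fL.
- by move=> _ [x Xx <-]; apply/sYZ/fXY.
- by exists f; split=> //; split=> // x Xx; exists x.
Qed.

(** As [beta w w = 0], adding a multiple of [w] to [u] preserves [beta u w], so the image determines
    [u]. In the form, the two cross terms cancel by skew symmetry. *)
Lemma transvection_embedding (X Y : set V) (w : V) :
  (forall u, beta u u = 0) -> submod_closed [in Y] -> X `<=` Y -> Y w ->
  isometric_embedding X Y (fun u => u + beta u w *: w).
Proof.
move=> alt /submod_setP[_ YD] sXY Yw; split.
- by move=> u /sXY Yu; rewrite addrC; apply: YD.
- move=> u v _ _ /= uvE.
  have : beta (u + beta u w *: w) w = beta (v + beta v w *: w) w by rewrite uvE.
  rewrite !linearDl !linearZl_LR /= alt !mulr0 !addr0 => wE.
  by move: uvE; rewrite wE => /addIr.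
- move=> a u v _ _; rewrite linearPl /= scalerDl scalerDr scalerA.
  by rewrite addrACA.
- move=> u v _ _.
  rewrite linearDl !linearDr !linearZl_LR /= !linearZr_LR /= alt !mulr0 addr0.
  by rewrite (skewC w v) mulrN mulrC -addrA subrr addr0.
Qed.

(* As beta x v = 1, this map sends x to s. *)
Lemma shift_embedding (X Y : set V) (x s v : V) :
  (forall u, beta u u = 0) -> submod_closed [in X] -> submod_closed [in Y] ->
  X `<=` Rad beta Y -> X x -> beta x v = 1 -> Y s -> ~ Rad beta Y s ->
  isometric_embedding X Y (fun y => y + beta y v *: (s - x)).
Proof.
move=> alt subX subY sXR Xx xv1 Ys nRs.
have [_ XD] := (submod_setP X).1 subX.
have [_ YD] := (submod_setP Y).1 subY.
have sXY u : X u -> Y u by move=> /sXR[].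
have Ysx : Y (s - x).
  by apply: (submodB subY) => //; apply: sXY.
have XXl u y : X u -> Y y -> beta u y = 0 by move=> /sXR[_]; apply.
have XXr u y : X u -> Y y -> beta y u = 0.
  by move=> Xu Yy; rewrite skewC XXl ?oppr0.
split.
- by move=> u /sXY Yu; rewrite addrC; apply: YD.
- move=> u u' /set_mem Xu /set_mem Xu' /= uu'E.
  have [cE|cN] := eqVneq (beta u v) (beta u' v).
    by move: uu'E; rewrite cE => /addIr.
  (* Two points with the same image but different pairings with [v] would make a nonzero multiple of
     [s - x] a vector of [X], so [s] would lie in [X] and hence in [Rad beta Y]. *)
  case: nRs.
  have d0 : beta u v - beta u' v != 0 by rewrite subr_eq0.
  have sE : s = (beta u v - beta u' v)^-1 *: (u' - u) + x.
    apply/eqP; rewrite -subr_eq -(inj_eq (scalerI d0)) scalerA divff // scale1r.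
    by rewrite scalerBl subr_eq addrAC eq_sym subr_eq -uu'E addrC.
  rewrite sE; apply/sXR/XD => //.
  exact: (submodB subX).
- move=> a u u' _ _; move: (s - x) => d.
  by rewrite linearPl /= scalerDl scalerDr scalerA addrACA.
(* The direction [d] lies in [Y], so it is orthogonal to [X] and to itself. The vector [v], which is
   outside [Y], enters only through scalars. *)
- move=> u u' Xu Xu'; move: (s - x) Ysx => d Yd.
  rewrite linearDl !linearDr !linearZl_LR /= !linearZr_LR /= alt.
  by rewrite (XXl u d) // (XXr u' d) // !mulr0 !addr0.
Qed.

End Forms.

(* The colour of X is its image in F^I under v |-> (beta v (p i))_i, a linear map
whose kernel is the radical. *)
Lemma Rad_coloring (F : finFieldType) (V : lmodType F)
    (beta : {skew_symmetric V}) (I : finType) (p : I -> V) :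
  (forall u, (forall i, beta u (p i) = 0) -> Rad beta setT u) ->
  exists (r : nat) (col : set V -> 'I_r),
    forall X Y, col X = col Y ->
      forall x, X x -> exists2 y, Y y & Rad beta setT (x - y).
Proof.
move=> radP.
pose t v := [ffun i => beta v (p i)].
(* The colours are the subsets of a finite space, so [r] depends only on [F] and [I]. *)
exists #|{set {ffun I -> F}}|.
exists (fun X => enum_rank [set c : {ffun I -> F} | `[< (t @` X) c >]]%SET).
move=> X Y /enum_rank_inj/setP colE x Xx.
have := colE (t x); rewrite !inE.
have -> : `[< (t @` X) (t x) >] by apply/asboolP; exists x.
move=> /esym/asboolP[y Yy tyx]; exists y => //; apply: radP => i.
by move/ffunP: tyx => /(_ i); rewrite !ffunE linearBl /= => <-; rewrite subrr.
Qed.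

(** The isometry [f] from [B] to a monochromatic [B'] carries the images of [g] and [h] to copies of
    [A] of one colour. Pairing the resulting difference with each [f w], for [w] in [B], pulls the
    conclusion back to [Rad beta B]. *)
Lemma arrow_embeddings (F : fieldType) (V : lmodType F)
    (beta : {skew_symmetric V}) (A B C : set V) (r : nat) (col : set V -> 'I_r) :
  (forall X Y, col X = col Y ->
     forall x, X x -> exists2 y, Y y & Rad beta setT (x - y)) ->
  finite_subspace A -> submod_closed [in B] -> arrow beta C B A r ->
  forall g h, isometric_embedding beta A B g -> isometric_embedding beta A B h ->
  forall x, A x -> exists2 y, A y & Rad beta B (g x - h y).
Proof.
move=> colP finA subB /(_ (fun X => col (val X))).
move=> [B' [_ sB'C [f [[fBB' fI fS] fL fB]]] mono] g h gE hE x Ax.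
have fE : isometric_embedding beta B B' f by [].
have fgE := isometric_embedding_comp gE fE.
have fhE := isometric_embedding_comp hE fE.
have Cg := copies_image finA fgE sB'C; have Ch := copies_image finA fhE sB'C.
have := mono (SigSub (mem_set Cg)) (SigSub (mem_set Ch)).
move=> /(_ (copies_image finA fgE _) (copies_image finA fhE _)).
move=> /= /(_ (@subset_refl _ _) (@subset_refl _ _)) /colP.
move=> /(_ (f (g x))) [|_ [y Ay <-] [_ rad]]; first by exists x.
exists y => //.
have Bg : B (g x) by case: gE => + _ _ _; apply.
have Bh : B (h y) by case: hE => + _ _ _; apply.
split=> [|w Bw]; first exact: (submodB subB).
have := rad (f w) I.
by rewrite linearBl /= !fB // -linearBl.
Qed.

(** In characteristic two, skew symmetry does not force [beta u u = 0]. It only cancels the cross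
    terms, which leaves the diagonal values on the basis. *)
Lemma basis_alternating (F : fieldType) (V : lmodType F)
    (beta : {skew_symmetric V}) (I : eqType) (p : I -> V) :
  is_basis p -> (forall i, beta (p i) (p i) = 0) -> forall u, beta u u = 0.
Proof.
move=> [_ _ gen] p0 u.
have [v [s [c ->]] /= /eqP] := gen u Logic.I; rewrite subr_eq0 => /eqP ->.
elim: s => [|i s IH]; first by rewrite big_nil linear0l.
rewrite big_cons linearDl !linearDr /= IH !linearZl_LR /= !linearZr_LR /= p0.
by rewrite (skewC beta _ (p i)) !mulr0 add0r addr0 mulrN subrr.
Qed.

Lemma basis_Rad (F : fieldType) (V : lmodType F)
    (beta : {skew_symmetric V}) (I : eqType) (p : I -> V) (u : V) :
  is_basis p -> (forall i, beta u (p i) = 0) -> Rad beta setT u.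
Proof.
move=> [_ _ gen] p0; split=> // x _.
have [v [s [c ->]] /= /eqP] := gen x Logic.I; rewrite subr_eq0 => /eqP ->.
by rewrite linear_sumr big1 // => i _; rewrite linearZr_LR /= p0 mulr0.
Qed.

Theorem theorem3p3 (k : nat) (k_ge1 : (1 <= k)%N)
    (V : lmodType 'F_2) (beta : {skew_symmetric V})
    (e : nat -> V) (es : 'I_k -> V)
    (basisV : is_basis (basis_family e es))
    (hyp_pairs : forall i : 'I_k, hyperbolic_pair beta (e i) (es i))
    (orth_pairs : forall i j : 'I_k, i != j ->
       forall u v, u \in [:: e i; es i] -> v \in [:: e j; es j] -> beta u v = 0)
    (radV : Rad beta [set: V] = linear_span (fun i : nat => e (k + i)%N))
    (A B : set V)
    (finA : finite_subspace A) (finB : finite_subspace B)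
    (ltAB : A `<` B)
    (B_neq_Rad : B <> Rad beta B)
    (a b : nat)
    (codimA : is_codim A (A `&` Rad beta [set: V]) a)
    (codimB : is_codim B (Rad beta B) b)
    (codim_ineq : (1 <= a < b)%N) :
  exists r : nat,
    forall C : set V, finite_subspace C -> ~ arrow beta C B A r.
Proof.
have radE i : (k <= i)%N -> Rad beta setT (e i).
  move=> ki; rewrite radV; exists [:: (i - k)%N], (fun=> 1).
  by rewrite big_seq1 scale1r subnKC.
have alt : forall u, beta u u = 0.
  apply: (basis_alternating basisV) => -[i|i] /=; first by case: (hyp_pairs i).
  have [ik|/radE[_]] := ltnP i k; last exact.
  by case: (hyp_pairs (Ordinal ik)).
(* All other basis vectors lie in the radical, so [2k] vectors suffice to detect it; this finite
   family defines the colouring. *)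
have radP u : (forall i : 'I_k + 'I_k,
    beta u (match i with inl i => es i | inr i => e i end) = 0) ->
    Rad beta setT u.
  move=> u0; apply: (basis_Rad basisV) => -[i|i] /=; first exact: (u0 (inl i)).
  have [ik|/radE[_ r0]] := ltnP i k; first exact: (u0 (inr (Ordinal ik))).
  by rewrite skewC r0 ?oppr0.
have [r [col colP]] := Rad_coloring radP.
exists r => C _ arr.
have subA := finA.1; have subB := finB.1.
have mono := arrow_embeddings colP finA subB arr.
have [sAB _] := ltAB.
have idE := isometric_embedding_sub beta sAB.
have /andP[a_ge1 ltab] := codim_ineq.
have [sAR|/existsNP[x /not_implyP[Ax nRx]]] := pselect (A `<=` Rad beta B).
  have [s Bs nRs] : exists2 s, B s & ~ Rad beta B s.
    apply: contrapT => nex; apply: B_neq_Rad; apply/seteqP.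
    split; last by move=> u [].
    by move=> s Bs; apply: contrapT => nRs; apply: nex; exists s.
  have [x Ax [v xv1]] : exists2 x, A x & exists v, beta x v = 1.
    apply: contrapT => nex.
    (* If [A] were orthogonal to all of [V], the basis vector [q i0], which exists because [a >= 1],
       would lie in [Rad V], against its independence modulo [A] meet [Rad V]. *)
    have [q [Aq indq _]] := codimA; pose i0 := Ordinal a_ge1.
    suff : (1 : 'F_2) = 0 by [].
    apply: (indq [:: i0] (fun=> 1) isT _ i0 (mem_head _ _)).
    rewrite big_seq1 scale1r; split=> //; split=> // v _.
    have [//|qv] := eqVneq (beta (q i0) v) 0; case: nex.
    exists (q i0) => //; exists ((beta (q i0) v)^-1 *: v).
    by rewrite linearZr_LR /= mulVf.
  have shiftE := shift_embedding alt subA subB sAR Ax xv1 Bs nRs.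
  have [y Ay] := mono _ _ shiftE idE _ Ax.
  rewrite xv1 scale1r (addrC x) subrK => rsy; apply: nRs.
  have [_ RD] := (submod_setP _).1 (submod_Rad beta subB).
  by have := RD 1 _ _ rsy (sAR _ Ay); rewrite scale1r subrK.
have [w0 Bw0 xw0] : exists2 w, B w & beta x w != 0.
  apply: contrapT => nex; apply: nRx; split=> [|w Bw]; first exact: sAB.
  by apply/eqP/negPn/negP => xw; apply: nex; exists w.
have [R0 RD] := (submod_setP _).1 (submod_Rad beta subB).
have [A0 AD] := (submod_setP _).1 subA.
have [_ BD] := (submod_setP _).1 subB.
have moved w : B w -> beta x w != 0 -> exists2 y, A y & Rad beta B (w - y).
  move=> Bw xw.
  have transvE := transvection_embedding alt subB sAB Bw.
  have [y Ay ry] := mono _ _ transvE idE _ Ax.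
  (* This solves [x + beta x w *: w = y] for [w], modulo [Rad beta B]. *)
  exists ((beta x w)^-1 *: (y - x)).
    have := AD (beta x w)^-1 (y - x) 0; rewrite addr0; apply=> //.
    exact: (submodB subA).
  have := RD (beta x w)^-1 _ _ ry R0; rewrite addr0.
  congr (Rad beta B _).
  by rewrite addrAC scalerDr scalerA mulVf // scale1r [LHS]addrC -scalerN opprB.
have sum w : B w -> exists2 y, A y & Rad beta B (w - y).
  move=> Bw; have [xw|/moved] := eqVneq (beta x w) 0; last exact.
  (* A vector [w] orthogonal to [x] is the difference of [w0 + w] and [w0], neither of which is
     orthogonal to [x]. *)
  have [|y0 Ay0 ry0] := moved _ Bw0; first by [].
  have [||y Ay ry] := moved (w0 + w).
  - by have := BD 1 _ _ Bw0 Bw; rewrite scale1r.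
  - by rewrite linearDr /= xw addr0.
  exists (y - y0); first exact: (submodB subA).
  have := submodB (submod_Rad beta subB) ry ry0; congr (Rad beta B _).
  by rewrite !opprB [LHS]addrC -!addrA addKr addrCA.
have : (b <= a)%N.
  (* The bound compares quotients by [Rad beta B] and by [A] meet [Rad V]; the latter is contained
     in the former because [A] lies in [B]. *)
  apply: codim_le sum codimB codimA; first exact: submod_Rad.
  by move=> u [Au [_ ru]]; split; [exact: sAB|move=> v _; apply: ru].
by rewrite leqNgt ltab.
Qed.
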